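(* Let $Z$ be an antipodal space, and suppose that some $\rho_0\in\mathcal{M}(Z)$ is an ultrametric. Then $\mathcal{M}(Z)$ is a tree, and all elements $\rho$ of $\mathcal{M}(Z)$ are ultrametrics.
   Context: Antipodal spaces and Moebius spaces. Let $Z$ be a compact metrizable space containing at least four points. A separating function on $Z$ is a continuous function $\rho : Z\times Z\to[0,\infty)$ which is symmetric and satisfies $\rho(\xi,\eta)=0$ if and only if $\xi=\eta$. Its cross-ratio is defined on quadruples of distinct points of $Z$ by $[\xi,\xi',\eta,\eta']_\rho=\frac{\rho(\xi,\eta)\rho(\xi',\eta')}{\rho(\xi,\eta')\rho(\xi',\eta)}$. Two separating functions are Moebius equivalent if their cross-ratios agree. If $\rho_1,\rho_2$ are Moebius equivalent, there is a unique positive continuous function $\frac{d\rho_2}{d\rho_1}:Z\to(0,\infty)$, the derivative, such that $\rho_2(\xi,\eta)^2=\frac{d\rho_2}{d\rho_1}(\xi)\frac{d\rho_2}{d\rho_1}(\eta)\rho_1(\xi,\eta)^2$ for all $\xi,\eta\in Z$. An antipodal function on $Z$ is a separating function $\rho$ such that $\sup_{\xi,\eta}\rho(\xi,\eta)=1$ and for every $\xi\in Z$ there is $\eta\in Z$ with $\rho(\xi,\eta)=1$. An antipodal space is such a space $Z$ equipped with an antipodal function $\alpha$. Its Moebius space $\mathcal{M}(Z)=\mathcal{M}(Z,\alpha)$ is the set of all antipodal functions on $Z$ Moebius equivalent to $\alpha$, with the metric $d_{\mathcal{M}}(\rho_1,\rho_2)=\left\|\log\frac{d\rho_2}{d\rho_1}\right\|_\infty$.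 An element $\rho$ is an ultrametric if $\rho(\xi,\eta)\le\max(\rho(\xi,\zeta),\rho(\zeta,\eta))$ for all $\xi,\eta,\zeta\in Z$. A tree means a metric (real) tree, i.e. a geodesic metric space that is $0$-hyperbolic. *)

(* Defs.v *)
From mathcomp Require Import all_boot all_order all_algebra.
From mathcomp Require Import all_classical all_reals all_analysis.
Import Order.TTheory GRing.Theory Num.Theory.
Import numFieldNormedType.Exports.

Set Implicit Arguments.
Unset Strict Implicit.
Unset Printing Implicit Defensive.

Local Open Scope classical_set_scope.
Local Open Scope ring_scope.

(* [d] is only constrained on the points of [X]: the metric space is [X]. *)
Definition is_metric (R : realType) (T : Type) (X : set T) (d : T -> T -> R) :=
  [/\ forall x y, X x -> X y -> 0 <= d x y,
      forall x y, X x -> X y -> (d x y = 0 <-> x = y),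
      forall x y, X x -> X y -> d x y = d y x &
      forall x y z, X x -> X y -> X z -> d x z <= d x y + d y z].

Definition geodesic (R : realType) (T : Type) (X : set T) (d : T -> T -> R) :=
  forall x y, X x -> X y -> exists gamma : R -> T,
    [/\ gamma 0 = x, gamma (d x y) = y,
        forall t, 0 <= t <= d x y -> X (gamma t) &
        forall s t, 0 <= s <= d x y -> 0 <= t <= d x y ->
          d (gamma s) (gamma t) = `|s - t|].

Definition gromov_product (R : realType) (T : Type) (d : T -> T -> R)
    (w x y : T) : R :=
  (d x w + d y w - d x y) / 2.

Definition zero_hyperbolic (R : realType) (T : Type) (X : set T)
    (d : T -> T -> R) :=
  forall w x y z, X w -> X x -> X y -> X z ->
    Num.min (gromov_product d w x y) (gromov_product d w y z)
      <= gromov_product d w x z.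

Definition is_tree (R : realType) (T : Type) (X : set T) (d : T -> T -> R) :=
  [/\ is_metric X d, geodesic X d & zero_hyperbolic X d].

Definition metrizable (R : realType) (Z : topologicalType) :=
  exists d : Z -> Z -> R, is_metric [set: Z] d /\
    forall (x : Z) (A : set Z),
      nbhs x A <-> exists2 e : R, 0 < e & [set y | d x y < e] `<=` A.

Section antipodal.
Variables (R : realType) (Z : topologicalType).
Implicit Types (rho : Z -> Z -> R) (f : Z -> R).

Definition separating rho :=
  [/\ continuous (fun p : Z * Z => rho p.1 p.2),
      forall xi eta, 0 <= rho xi eta,
      forall xi eta, rho xi eta = rho eta xi &
      forall xi eta, rho xi eta = 0 <-> xi = eta].

Definition cross_ratio rho (xi xi' eta eta' : Z) : R :=
  (rho xi eta * rho xi' eta') / (rho xi eta' * rho xi' eta).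

Definition moebius_equiv rho1 rho2 :=
  forall xi xi' eta eta' : Z, uniq [:: xi; xi'; eta; eta'] ->
    cross_ratio rho1 xi xi' eta eta' = cross_ratio rho2 xi xi' eta eta'.

Definition is_moebius_derivative rho1 rho2 f :=
  [/\ continuous f, forall xi, 0 < f xi &
      forall xi eta, rho2 xi eta ^+ 2 = f xi * f eta * rho1 xi eta ^+ 2].

(* [moebius_derivative rho1 rho2] is d rho2 / d rho1; the default value 1 is
   irrelevant when rho1 and rho2 are Moebius equivalent separating functions on
   a space with at least four points, where the derivative exists and is
   unique. *)
Definition moebius_derivative rho1 rho2 : Z -> R :=
  xget (fun=> 1) [set f | is_moebius_derivative rho1 rho2 f].

Definition sup_norm f : R := sup [set `|f xi| | xi in [set: Z]].

(* [sup] is 0 on sets that are empty or unbounded, so [sup _ = 1] entails that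
   rho is bounded. *)
Definition antipodal rho :=
  [/\ separating rho,
      sup [set rho p.1 p.2 | p in [set: Z * Z]] = 1 &
      forall xi, exists eta, rho xi eta = 1].

Definition antipodal_space (alpha : Z -> Z -> R) :=
  [/\ compact [set: Z], metrizable R Z, (`I_4 #<= [set: Z])%card &
      antipodal alpha].

Definition moebius_space (alpha : Z -> Z -> R) : set (Z -> Z -> R) :=
  [set rho | antipodal rho /\ moebius_equiv rho alpha].

Definition moebius_dist rho1 rho2 : R :=
  sup_norm (fun xi => ln (moebius_derivative rho1 rho2 xi)).

Definition ultrametric rho :=
  forall xi eta zeta, rho xi eta <= Num.max (rho xi zeta) (rho zeta eta).

End antipodal.

Arguments moebius_dist {R Z} rho1 rho2.

(* Main.v *)
Require Import Defs.
From mathcomp Require Import all_boot all_order all_algebra.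
From mathcomp Require Import all_classical all_reals all_analysis.
From mathcomp Require Import ring lra.

(** Let [w] be an ultrametric antipodal function.  Think of [w] as the visual
metric [exp (- (x|y)_o)] of the boundary of a tree with root [o].  For a
boundary point [xi] and [0 < r <= 1], the point of the ray from [o] to [xi] at
distance [- ln r] from [o] sees the boundary through
[[
  visual w xi r x y = r w(x,y) / (max(w(x,xi),r) max(w(y,xi),r)),
]]
the rescaling of [w] by the exponential of a Busemann function.  The proof
shows that these functions exhaust the Moebius space, and computes with them.

Ultrametricity.  The inequality
[w(a,b) w(c,d) <= max (w(a,c) w(b,d), w(a,d) w(b,c))] follows from the
ultrametric one.  It is invariant under rescalings
[w(x,y) |-> c(x) c(y) w(x,y)], hence under Moebius equivalence.  In an antipodal
function it gives the ultrametric inequality back, by taking for [d] a point at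
distance 1 from [c].  So every element of the Moebius space is an ultrametric
([moebius_space_ultrametric]), and each of them can serve as the base point [w].

Parametrization ([moebius_space_visual]).  Let [rho] be in the Moebius space and
let [f] be its derivative with respect to [w].  By compactness [f] has a maximum
[1 / r], at [xi] say.  The bound [rho <= 1] between [xi] and any point shows
that [f] is at most the derivative [r / max(w(x,xi),r)^2] of [visual w xi r].
Conversely no antipodal function lies below another one of its Moebius class,
since every point has an antipode, at distance 1; so the two coincide.

Distances ([dist_visual]).  Between antipodal functions the sup norm of the
logarithm of the derivative is the logarithm of its maximum, and for two visual
functions this maximum is explicit.  Seen from [w], the Gromov product of
[visual w xi a] and [visual w eta b] is [- ln (max (w(xi,eta), a, b))]
([gromov_product_visual]).  Hence 0-hyperbolicity is again the ultrametric
inequality for [w], the metric axioms follow by letting the base point vary, and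
[t |-> visual w xi (exp (- t))] is a geodesic from [w]. *)

Import Order.TTheory GRing.Theory Num.Theory.
Import numFieldNormedType.Exports.

Set Implicit Arguments.
Unset Strict Implicit.
Unset Printing Implicit Defensive.

Local Open Scope classical_set_scope.
Local Open Scope ring_scope.

(** * Auxiliary facts on cardinals, products and suprema *)

Lemma card_ge4_avoid2 (T : Type) (x y : T) :
  (`I_4 #<= [set: T])%card -> exists z, z <> x /\ z <> y.
Proof.
move=> /card_leP[f]; apply: contrapT => none.
pose g i (h : (i < 4)%N) := val (f (SigSub (mem_set (h : `I_4 i)))).
have g_inj i j hi hj : @g i hi = @g j hj -> i = j.
  by move=> /val_inj /inj-/(_ (mem_set I) (mem_set I)) /(congr1 val).
have col i h : @g i h = x \/ @g i h = y.
  have [|gx] := pselect (@g i h = x); first by left.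
  by right; apply: contrapT => gy; apply: none; exists (g i h).
have h0 : (0 < 4)%N by [].
have h1 : (1 < 4)%N by [].
have h2 : (2 < 4)%N by [].
have n01 : g 0%N h0 <> g 1%N h1 by move=> /g_inj.
have n02 : g 0%N h0 <> g 2%N h2 by move=> /g_inj.
have n12 : g 1%N h1 <> g 2%N h2 by move=> /g_inj.
by case: (col 0%N h0) (col 1%N h1) (col 2%N h2) =>
   [a|a] [b|b] [c|c]; congruence.
Qed.

Lemma eq_ratio_cross (F : realFieldType) (r1 r2 r3 r4 w1 w2 w3 w4 : F) :
  0 < r2 -> 0 < r3 -> 0 < w1 -> 0 < w2 -> 0 < w3 -> 0 < w4 ->
  r1 * r4 / (r2 * r3) = w1 * w4 / (w2 * w3) ->
  r1 / w1 * (r4 / w4) = r2 / w2 * (r3 / w3).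
Proof.
move=> ? ? ? ? ? ? H.
have e : r1 * r4 = r1 * r4 / (r2 * r3) * (r2 * r3) by field; lra.
by rewrite mulf_div e H; field; lra.
Qed.

Lemma mulf_cross_cancel (F : fieldType) (p q s : F) :
  q != 0 -> s != 0 -> (p * q / s) * (p * s / q) = p ^+ 2.
Proof. by move=> *; field; apply/andP; split. Qed.

Lemma eq_of_pairwise_products (F : realFieldType) (a b c a' b' c' : F) :
  0 < a -> 0 < b -> 0 < c -> 0 < a' ->
  a * b = a' * b' -> a * c = a' * c' -> b * c = b' * c' -> a = a'.
Proof.
move=> a0 b0 c0 a'0 ab ac bc.
have bc0 : b * c != 0 by rewrite mulf_neq0 ?gt_eqF.
have : a ^+ 2 * (b * c) = a' ^+ 2 * (b * c).
  by rewrite {2}bc expr2 mulrACA ab ac; ring.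
by move=> /(mulIf bc0) /eqP; rewrite eqrXn2 ?ltW // => /eqP.
Qed.

Section moebius_derivative.
Variables (R : realType) (Z : topologicalType).
Implicit Types (rho w : Z -> Z -> R) (f : Z -> R).

Lemma sup_attained (A : set R) m : A m -> ubound A m -> sup A = m.
Proof.
move=> Am ubm; apply/eqP; rewrite eq_le; apply/andP; split.
  by apply: ge_sup => //; exists m.
by apply: ub_le_sup => //; exists m.
Qed.

(** * Separating and antipodal functions *)

Lemma antipodal_has_sup rho :
  antipodal rho -> has_sup [set rho p.1 p.2 | p in [set: Z * Z]].
Proof.
case=> _ sup1 _; apply: contrapT => /sup_out s0; move: sup1.
by rewrite s0 => /esym/eqP; rewrite oner_eq0.
Qed.

Lemma antipodal_le1 rho x y : antipodal rho -> rho x y <= 1.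
Proof.
move=> arho; have [_ <- _] := arho.
by apply: (sup_upper_bound (antipodal_has_sup arho)); exists (x, y).
Qed.

Lemma antipodal_inhabited rho : antipodal rho -> [set: Z] !=set0.
Proof. by move=> /antipodal_has_sup[[_ [[x _] _ _]] _]; exists x. Qed.

Section separating.
Variables (rho : Z -> Z -> R) (sep : separating rho).

Lemma separating_ge0 x y : 0 <= rho x y. Proof. by case: sep. Qed.
Lemma separatingC x y : rho x y = rho y x. Proof. by case: sep. Qed.

Lemma separatingxx x : rho x x = 0.
Proof. by case: sep => _ _ _ /(_ x x)[_]; apply. Qed.

Lemma separating_gt0 x y : x <> y -> 0 < rho x y.
Proof.
move=> xy; rewrite lt_neqAle separating_ge0 andbT eq_sym; apply/eqP.
by case: sep => _ _ _ /(_ x y) [h _] /h.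
Qed.

Lemma separating_continuous y : continuous (rho ^~ y).
Proof.
move=> x; case: sep => + _ _ _ => /(_ (x, y)) c.
apply: (@continuous_comp _ _ _ (fun x => (x, y)) (fun p => rho p.1 p.2)).
  by apply: cvg_pair; [exact: cvg_id | exact: cvg_cst].
exact: c.
Qed.

Lemma near_neq (x y : Z) : x <> y -> \forall z \near x, z <> y.
Proof.
move=> xy; have := @separating_continuous y x.
move=> /cvgr_gt /(_ _ (separating_gt0 xy)) N.
by apply: filterS N => z + zy; rewrite zy separatingxx ltxx.
Qed.

End separating.

(** * The Moebius derivative *)

Section derivative.
Variables w rho : Z -> Z -> R.
Hypotheses (sw : separating w) (srho : separating rho).
Hypothesis equiv : moebius_equiv rho w.
Hypothesis avoid2 : forall x y : Z, exists z, z <> x /\ z <> y.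

(* If the derivative [f] exists, then [f x * f y = k x y ^+ 2] for [x <> y]. *)
Let k x y := rho x y / w x y.

Let k_gt0 x y : x <> y -> 0 < k x y.
Proof. by move=> xy; rewrite divr_gt0 // separating_gt0. Qed.

Let kC x y : k x y = k y x.
Proof. by rewrite /k separatingC // (separatingC sw). Qed.

Let k_cross x x' y y' : uniq [:: x; x'; y; y'] ->
  k x y * k x' y' = k x y' * k x' y.
Proof.
move=> u; have := equiv u; rewrite /cross_ratio /k.
move: u; rewrite /= !inE !negb_or => /andP[/and3P[_ /eqP a /eqP b]].
move=> /andP[/andP[/eqP c /eqP d] _].
have := separating_gt0 sw a; have := separating_gt0 sw b.
have := separating_gt0 sw c; have := separating_gt0 sw d.
have := separating_gt0 srho a; have := separating_gt0 srho b.
have := separating_gt0 srho c; have := separating_gt0 srho d.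
by move=> *; apply: eq_ratio_cross.
Qed.

(* The value of [f x] forced by the equations for the pairs from [x, y, z]. *)
Let D x y z := k x y * k x z / k y z.

Let D_swap x y z : D x y z = D x z y.
Proof. by rewrite /D (kC z y) (mulrC (k x z)). Qed.

Let D_step x y y' z : y <> x -> y' <> x -> z <> x -> y <> z -> y' <> z ->
  D x y z = D x y' z.
Proof.
move=> yx y'x zx yz y'z; have [->//|/eqP yy'] := eqVneq y y'.
have := @k_cross x z y y'.
rewrite /= !inE !negb_or => /(_ _)/wrap[].
  by rewrite !andbT; do !(apply/andP; split); apply/eqP => // /esym.
rewrite /D (kC z y') (kC z y) => H.
have [/lt0r_neq0 c0 /lt0r_neq0 d0] := (k_gt0 yz, k_gt0 y'z).
by apply/eqP; rewrite eqr_div // mulrAC H mulrAC.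
Qed.

(* Two pairs may overlap crosswise, so that replacing the points one at a time
   would pass through a degenerate pair; the symmetry [D_swap] avoids this. *)
Let D_wd x y z y' z' : y <> x -> z <> x -> y <> z ->
  y' <> x -> z' <> x -> y' <> z' -> D x y z = D x y' z'.
Proof.
move=> yx zx yz y'x z'x y'z'.
have [y'z|/eqP y'z] := eqVneq y' z.
  rewrite y'z in y'x y'z' *; rewrite [RHS]D_swap.
  by apply: D_step => // /esym.
rewrite (@D_step x y y' z) // D_swap [RHS]D_swap.
by apply: D_step => // /esym.
Qed.

(** Equality of cross-ratios makes [D x y z] independent of [y] and [z].  Near a
given point these two can be kept fixed, whence continuity. *)
Lemma moebius_derivative_exists : exists f, is_moebius_derivative w rho f.
Proof.
have /choice[f Df] x : exists v, forall y z, y <> x -> z <> x -> y <> z ->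
    v = D x y z.
  have [y [yx _]] := avoid2 x x; have [z [zx zy]] := avoid2 x y.
  by exists (D x y z) => *; apply: D_wd => // /esym.
exists f; split.
- move=> x.
  have [y [yx _]] := avoid2 x x; have [z [zx zy]] := avoid2 x y.
  have yz : y <> z by move/esym.
  have fx : f x = D x y z by exact: Df.
  suff: f u @[u --> x] --> D x y z by rewrite -fx.
  have kcvg t : t <> x -> k u t @[u --> x] --> k x t.
    move=> tx; apply: cvgM; first exact: separating_continuous.
    apply: cvgV; last exact: separating_continuous.
    by rewrite gt_eqF // separating_gt0 // => /esym.
  have Dcvg : D u y z @[u --> x] --> D x y z.
    by apply: cvgM; [apply: cvgM; exact: kcvg | exact: cvg_cst].
  apply: cvg_trans Dcvg; apply: near_eq_cvg; near=> u.
  apply/esym/Df => // /esym; near: u; by apply: (near_neq sw); move=> /esym.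
- move=> x; have [y [yx _]] := avoid2 x x; have [z [zx zy]] := avoid2 x y.
  rewrite (Df x y z) //; last by move=> /esym.
  by apply: divr_gt0; [apply: mulr_gt0|]; apply: k_gt0 => /esym.
- move=> x y; have [->|/eqP xy] := eqVneq x y.
    by rewrite !separatingxx // expr0n mulr0.
  have [z [zx zy]] := avoid2 x y.
  rewrite (Df x y z) // ?(Df y x z) //; try by move=> /esym.
  have xz : x <> z by move/esym.
  have yz : y <> z by move/esym.
  rewrite /D (kC y x) mulf_cross_cancel ?gt_eqF ?k_gt0 //.
  by rewrite -exprMn divfK // gt_eqF // separating_gt0.
Unshelve. all: by end_near. Qed.

Lemma moebius_derivative_unique f g :
  is_moebius_derivative w rho f -> is_moebius_derivative w rho g -> f = g.
Proof.
move=> [_ f0 fE] [_ g0 gE].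
have fg x y : x <> y -> f x * f y = g x * g y.
  move=> xy; have w2 : w x y ^+ 2 != 0.
    by rewrite expf_neq0 // gt_eqF // separating_gt0.
  by apply: (mulIf w2); rewrite -fE -gE.
apply/funext => x.
have [y [yx _]] := avoid2 x x; have [z [zx zy]] := avoid2 x y.
have /fg xy : x <> y by move/esym.
have /fg xz : x <> z by move/esym.
have /fg yz : y <> z by move/esym.
exact: eq_of_pairwise_products xy xz yz.
Qed.

End derivative.

Lemma moebius_derivativeV w rho f : is_moebius_derivative w rho f ->
  is_moebius_derivative rho w (fun x => (f x)^-1).
Proof.
move=> [fc f0 fE]; split.
- by move=> x; apply: cvgV; [rewrite gt_eqF | exact: fc].
- by move=> x; rewrite invr_gt0.
- move=> x y; rewrite fE mulrA; have := f0 x; have := f0 y.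
  move: (f x) (f y) => a b b0 a0.
  by rewrite -invfM mulVf ?mul1r // mulf_neq0 // gt_eqF.
Qed.

(** The witness is an antipode of [x] for [rho]; consequently the minimum of the
derivative is at least the inverse of its maximum. *)
Lemma moebius_derivative_ge1 w rho f x : antipodal w -> antipodal rho ->
  is_moebius_derivative w rho f -> exists y, 1 <= f x * f y.
Proof.
move=> aw [_ _ /(_ x)[y rxy]] [_ f0 fE]; exists y.
have := fE x y; rewrite rxy expr1n => ->.
rewrite ler_piMr ?mulr_ge0 ?(ltW (f0 _)) //.
by rewrite expr_le1 ?antipodal_le1 //; case: aw => /separating_ge0.
Qed.

Lemma moebius_derivativeE w rho f :
  (forall x y : Z, exists z, z <> x /\ z <> y) ->
  separating w -> is_moebius_derivative w rho f ->
  moebius_derivative w rho = f.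
Proof.
move=> avoid2 sw df; apply: (moebius_derivative_unique (w:=w) (rho:=rho)) => //.
by apply: (@xgetPex _ _ [set f | is_moebius_derivative w rho f]); exists f.
Qed.

Lemma moebius_distC w rho :
  (forall x y : Z, exists z, z <> x /\ z <> y) ->
  separating w -> separating rho -> moebius_equiv rho w ->
  moebius_dist rho w = moebius_dist w rho.
Proof.
move=> avoid2 sw sr e; have [f df] := moebius_derivative_exists sw sr e avoid2.
rewrite /moebius_dist (moebius_derivativeE avoid2 sw df).
rewrite (moebius_derivativeE avoid2 sr (moebius_derivativeV df)) /sup_norm.
congr (sup _); apply: eq_imagel => x _ /=.
by case: df => _ f0 _; rewrite lnV ?posrE // normrN.
Qed.

(** The sup norm of [ln f] is attained at the maximum of [f] because
[moebius_derivative_ge1] bounds [f] below by [1 / f x0]. *)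
Lemma moebius_dist_max w rho f x0 :
  (forall x y : Z, exists z, z <> x /\ z <> y) ->
  antipodal w -> antipodal rho -> is_moebius_derivative w rho f ->
  (forall x, f x <= f x0) -> moebius_dist w rho = ln (f x0).
Proof.
move=> avoid2 aw ar df fmax.
have [sw _ _] := aw; have [_ f0 _] := df.
have bnd x : `|ln (f x)| <= ln (f x0).
  rewrite ler_norml ler_ln ?posrE // fmax andbT -lnV ?posrE //.
  rewrite ler_ln ?posrE ?invr_gt0 // -div1r ler_pdivrMr //.
  have [y /le_trans] := moebius_derivative_ge1 x aw ar df; apply.
  by rewrite ler_pM2l.
rewrite /moebius_dist (moebius_derivativeE avoid2 sw df); apply: sup_attained.
  by exists x0 => //; apply/ger0_norm; apply: le_trans (bnd x0).
by move=> _ [x _ <-].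
Qed.

Lemma moebius_equiv_conformal w rho (c : Z -> R) :
  (forall x, c x != 0) -> (forall x y, rho x y = c x * c y * w x y) ->
  moebius_equiv rho w.
Proof.
move=> c0 rhoE x x' y y' _; rewrite /cross_ratio !rhoE.
have C0 : c x * c x' * (c y * c y') != 0 by rewrite !mulf_neq0.
transitivity ((c x * c x' * (c y * c y')) * (w x y * w x' y') /
  ((c x * c x' * (c y * c y')) * (w x y' * w x' y))).
  by congr (_ / _); ring.
by rewrite -mulf_div divff // mul1r.
Qed.

(** * The multiplicative four-point inequality *)

(** The four-point condition of tree metrics, written for [ln rho].  Unlike the
ultrametric inequality, it is invariant under conformal rescaling. *)
Definition four_point rho := forall a b c d,
  rho a b * rho c d <= Num.max (rho a c * rho b d) (rho a d * rho b c).

(** The hypotheses are the triangle inequalities for two opposite sides [u], [v]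
of a quadrilateral whose other pairs of opposite sides are [p], [q] and
[s], [t]. *)
Lemma ultrametric_mul_le (p q s t u v : R) :
  0 <= u -> 0 <= v ->
  u <= Num.max p t -> u <= Num.max s q ->
  v <= Num.max p s -> v <= Num.max t q ->
  u * v <= Num.max (p * q) (s * t).
Proof.
move=> u0 v0.
have le_pq a b : (a = p /\ b = q) \/ (a = q /\ b = p) ->
    u <= a -> v <= b -> u * v <= Num.max (p * q) (s * t).
  move=> ab ua vb; rewrite le_max; apply/orP; left.
  apply: le_trans (ler_pM u0 v0 ua vb) _.
  by case: ab => -[-> ->] //; rewrite mulrC.
have le_st a b : (a = s /\ b = t) \/ (a = t /\ b = s) ->
    u <= a -> v <= b -> u * v <= Num.max (p * q) (s * t).
  move=> ab ua vb; rewrite le_max; apply/orP; right.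
  apply: le_trans (ler_pM u0 v0 ua vb) _.
  by case: ab => -[-> ->] //; rewrite mulrC.
have [pt|/ltW tp] := leP p t => ut usq vps vtq.
  move: vps; have [ps|/ltW sp] := leP p s => vps.
    by apply: le_st ut vps; right.
  move: usq; have [qs|sq] := leP s q => usq.
    by apply: le_pq usq vps; right.
  by apply: le_st usq (le_trans vps pt); left.
move: vtq; have [qt|/ltW tq] := leP t q => vtq.
  by apply: le_pq ut vtq; left.
move: usq; have [sq|qs] := leP s q => usq; last by apply: le_st usq vtq; left.
by apply: le_pq usq (le_trans vtq tp); right.
Qed.

Lemma ultrametric_four_point w :
  separating w -> ultrametric w -> four_point w.
Proof.
move=> sw uw a b c d; have w0 := separating_ge0 sw; have wC := separatingC sw.
apply: ultrametric_mul_le => //.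
- by rewrite (wC b c).
- by rewrite (wC b d).
- by rewrite (wC a c).
- by rewrite (wC b c).
Qed.

Lemma four_point_conformal w rho f : separating w -> separating rho ->
  is_moebius_derivative w rho f -> four_point w -> four_point rho.
Proof.
move=> sw sr [_ f0 fE] fw a b c d.
have w0 := separating_ge0 sw; have r0 := separating_ge0 sr.
have key p q s t p' q' s' t' :
    f p * f q * (f s * f t) = f p' * f q' * (f s' * f t') ->
    w p q * w s t <= w p' q' * w s' t' ->
    rho p q * rho s t <= rho p' q' * rho s' t'.
  move=> fF h; rewrite -(@ler_pXn2r _ 2) ?nnegrE ?mulr_ge0 // !exprMn !fE.
  rewrite mulrACA [leRHS]mulrACA fF ler_pM2l ?mulr_gt0 //.
  by rewrite -!exprMn ler_pXn2r ?nnegrE ?mulr_ge0.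
have := fw a b c d; rewrite !le_max => /orP[] /key h; apply/orP; [left|right];
  by apply: h; ring.
Qed.

(** The four-point inequality for [x, y, z] and an antipode of [z] has
[rho x y] on its left-hand side, and on its right-hand side the two other sides
of the triangle, each multiplied by a factor at most 1. *)
Lemma four_point_ultrametric rho :
  antipodal rho -> four_point rho -> ultrametric rho.
Proof.
move=> arho fp x y z; have [[_ r0 rC _] _ /(_ z)[w zw]] := arho.
have := fp x y z w; rewrite zw mulr1 => /le_trans; apply.
rewrite ge_max !le_max (rC z y); apply/andP; split; apply/orP; [left|right].
  by rewrite ler_piMr ?antipodal_le1.
by rewrite ler_piMl ?antipodal_le1.
Qed.

End moebius_derivative.

(** * The functions seen from the points of a ray *)

Section visual.
Variables (R : realType) (Z : topologicalType) (w : Z -> Z -> R).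
Hypotheses (aw : antipodal w) (uw : ultrametric w).
Hypothesis avoid2 : forall x y : Z, exists z, z <> x /\ z <> y.

(** The square root of the derivative of [visual xi r] with respect to [w] is
[sqrt r / gauge xi r x] at [x]. *)
Definition gauge (xi : Z) (r : R) (x : Z) : R := Num.max (w x xi) r.

Definition visual (xi : Z) (r : R) (x y : Z) : R :=
  r * w x y / (gauge xi r x * gauge xi r y).

Let sw : separating w. Proof. by case: aw. Qed.
Let w0 x y : 0 <= w x y. Proof. exact: separating_ge0. Qed.
Let wC x y : w x y = w y x. Proof. exact: separatingC. Qed.
Let wxx x : w x x = 0. Proof. exact: separatingxx. Qed.
Let w1 x y : w x y <= 1. Proof. exact: antipodal_le1. Qed.

Lemma gauge_gt0 xi r x : 0 < r -> 0 < gauge xi r x.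
Proof. by move=> r0; rewrite /gauge lt_max r0 orbT. Qed.

Lemma gauge_self xi r : 0 < r -> gauge xi r xi = r.
Proof. by move=> /ltW r0; rewrite /gauge wxx max_r. Qed.

Lemma gauge_continuous xi r : continuous (gauge xi r).
Proof.
move=> x; apply: (@continuous_max _ _ (w ^~ xi) (fun=> r)).
  exact: separating_continuous.
exact: cvg_cst.
Qed.

Lemma visual1 xi : visual xi 1 = w.
Proof.
have g1 x : gauge xi 1 x = 1 by rewrite /gauge max_r.
by apply/funext => x; apply/funext => y; rewrite /visual !g1 !mul1r divr1.
Qed.

(** The larger of [w x xi] and [w y xi] bounds [w x y], and the gauge at the
other point is at least [r]. *)
Lemma visual_le1 xi r x y : 0 < r -> visual xi r x y <= 1.
Proof.
move=> r0; rewrite /visual ler_pdivrMr ?mulr_gt0 ?gauge_gt0 // mul1r.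
have : w x y <= Num.max (w x xi) (w y xi) by rewrite (wC y).
rewrite le_max => /orP[] h; last rewrite mulrC.
  by rewrite mulrC ler_pM ?(ltW r0) // /gauge le_max ?h ?lexx ?orbT.
by rewrite [leRHS]mulrC ler_pM ?(ltW r0) // /gauge le_max ?h ?lexx ?orbT.
Qed.

Lemma visual_separating xi r : 0 < r -> separating (visual xi r).
Proof.
move=> r0; have g0 x := gauge_gt0 xi x r0; split.
- move=> [x y]; apply: cvgM.
    apply: cvgM; first exact: cvg_cst.
    by case: sw => + _ _ _; apply.
  apply: cvgV; first by rewrite mulf_neq0 // gt_eqF.
  apply: cvgM.
    apply: (@continuous_comp _ _ _ fst (gauge xi r)); first exact: cvg_fst.
    exact: gauge_continuous.
  apply: (@continuous_comp _ _ _ snd (gauge xi r)); first exact: cvg_snd.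
  exact: gauge_continuous.
- by move=> x y; rewrite divr_ge0 ?mulr_ge0 // ltW.
- by move=> x y; rewrite /visual wC (mulrC (gauge _ _ _)).
- move=> x y; split => [/eqP|->]; last by rewrite /visual wxx mulr0 mul0r.
  rewrite /visual !mulf_eq0 invr_eq0 mulf_eq0 (gt_eqF r0) !(gt_eqF (g0 _)) /=.
  rewrite !orbF => /eqP.
  by case: sw => _ _ _ /(_ x y)[h _] /h.
Qed.

(** The point [xi] is an antipode of every point outside the ball of radius [r]
around [xi].  If [r < 1], a point of this ball has as antipode any point at
distance 1 for [w] from [xi]; if [r = 1], the function is [w] itself. *)
Lemma visual_antipodal xi r : 0 < r <= 1 -> antipodal (visual xi r).
Proof.
move=> /andP[r0 r1].
have anti x : exists y, visual xi r x y = 1.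
  have [wxr|rwx] := leP (w x xi) r; last first.
    exists xi; rewrite /visual gauge_self // /gauge max_l ?ltW //.
    by rewrite (mulrC r) divff // mulf_neq0 // gt_eqF // (lt_trans r0).
  move: r1; rewrite le_eqVlt => /orP[/eqP ->|r1].
    by rewrite visual1; case: aw.
  have [_ _ /(_ xi)[y xiy]] := aw; exists y.
  have wxy : w x y = 1.
    apply/eqP; rewrite eq_le w1 /=; have := uw xi y x; rewrite xiy le_max.
    by rewrite wC leNgt (le_lt_trans wxr r1).
  rewrite /visual /gauge (wC y xi) xiy wxy max_r // max_l ?ltW //.
  by rewrite !mulr1 divff // gt_eqF.
split; [exact: visual_separating | | exact: anti].
have [_ _ /(_ xi)[eta _]] := aw; have [y xy] := anti xi.
apply: sup_attained; first by exists (xi, y).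
by move=> _ [[a b] _ <-]; apply: visual_le1.
Qed.

Lemma visual_moebius_space xi r : 0 < r <= 1 -> moebius_space w (visual xi r).
Proof.
move=> r01; split; first exact: visual_antipodal.
have /andP[r0 _] := r01; have g0 x := gauge_gt0 xi x r0.
apply: (@moebius_equiv_conformal _ _ _ _ (fun x => Num.sqrt r / gauge xi r x)).
  by move=> x; rewrite mulf_neq0 ?invr_eq0 ?gt_eqF ?sqrtr_gt0.
move=> x y; rewrite mulf_div -expr2 sqr_sqrtr ?ltW //.
by rewrite /visual mulrAC.
Qed.

Lemma visual_derivative xi a eta b : 0 < a -> 0 < b ->
  is_moebius_derivative (visual xi a) (visual eta b)
    (fun x => b / gauge eta b x ^+ 2 * (gauge xi a x ^+ 2 / a)).
Proof.
move=> a0 b0; have ga x := gauge_gt0 xi x a0; have gb x := gauge_gt0 eta x b0.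
split.
- move=> x; apply: cvgM; apply: cvgM; try exact: cvg_cst.
    apply: cvgV; first by rewrite expf_neq0 // gt_eqF.
    by apply: cvgM; exact: gauge_continuous.
  by apply: cvgM; exact: gauge_continuous.
- by move=> x; rewrite mulr_gt0 // divr_gt0 // exprn_gt0.
- move=> x y; rewrite /visual; field.
  by rewrite !gt_eqF.
Qed.

(* The derivative is largest at [eta]: by the ultrametric inequality its numerator
   [gauge xi a x] exceeds [gauge xi a eta] only if it is at most [w x eta], and
   then, as [b <= gauge xi a eta], the denominator [gauge eta b x] compensates. *)
Let dist_visual_le xi (a : R) eta (b : R) : 0 < a <= 1 -> 0 < b <= 1 ->
  b <= Num.max (w xi eta) a ->
  moebius_dist (visual xi a) (visual eta b) =
    ln (Num.max (w xi eta) (Num.max a b) ^+ 2 / (a * b)).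
Proof.
move=> a01 b01 bm; have [/andP[a0 _] /andP[b0 _]] := (a01, b01).
pose f x := b / gauge eta b x ^+ 2 * (gauge xi a x ^+ 2 / a).
have fmax x : f x <= f eta.
  rewrite /f gauge_self //.
  have g0 := gauge_gt0 eta x b0.
  have sqE u v : b / v ^+ 2 * (u ^+ 2 / a) = b / a * (u / v) ^+ 2.
    by rewrite expr_div_n; ring.
  rewrite !sqE ler_pM2l ?divr_gt0 //.
  have q0 := ltW (gauge_gt0 xi x a0); have m0 := ltW (gauge_gt0 xi eta a0).
  rewrite ler_pXn2r ?nnegrE ?divr_ge0 ?(ltW g0) ?(ltW b0) //.
  rewrite ler_pdivrMr // mulrAC ler_pdivlMr //.
  have bm' : b <= gauge xi a eta by rewrite /gauge (wC eta).
  have : gauge xi a x <= Num.max (w x eta) (gauge xi a eta).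
    rewrite /gauge ge_max !le_max lexx !orbT andbT orbA -le_max.
    by rewrite (uw x xi eta).
  rewrite le_max => /orP[qw|qm].
    by rewrite [leRHS]mulrC ler_pM ?(ltW g0) ?(ltW b0) // /gauge le_max qw.
  by rewrite ler_pM ?(ltW g0) ?(ltW b0) // /gauge le_max lexx orbT.
rewrite (moebius_dist_max avoid2 (visual_antipodal xi a01)
  (visual_antipodal eta b01) (visual_derivative xi eta a0 b0) fmax).
rewrite /f gauge_self // /gauge maxA (wC eta); congr ln.
by rewrite [Num.max (Num.max _ _) b]max_l //; field; rewrite !gt_eqF.
Qed.

(** When the maximum of the derivative is not at [eta], that of the inverse
derivative is at [xi], and the symmetry of the distance applies. *)
Lemma dist_visual xi (a : R) eta (b : R) : 0 < a <= 1 -> 0 < b <= 1 ->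
  moebius_dist (visual xi a) (visual eta b) =
    ln (Num.max (w xi eta) (Num.max a b) ^+ 2 / (a * b)).
Proof.
move=> a01 b01; have [ba|ab] := leP b (Num.max (w xi eta) a).
  exact: dist_visual_le.
have [[[sa _ _] ea] [[sb _ _] eb]] :=
  (visual_moebius_space xi a01, visual_moebius_space eta b01).
have ab' : a <= Num.max (w eta xi) b.
  rewrite le_max [X in _ || X]ltW ?orbT // (le_lt_trans _ ab) // le_max.
  by rewrite lexx orbT.
rewrite (moebius_distC avoid2 sb sa); last by move=> *; rewrite ea // eb.
by rewrite dist_visual_le // (wC eta) (maxC b) (mulrC b).
Qed.

Hypothesis cptZ : compact [set: Z].

(** With [xi] a maximum point of the derivative [f] of [rho] and
[r = 1 / f xi], the derivative [G] of [visual xi r] dominates [f]; minimality of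
antipodal functions turns this into equality. *)
Lemma moebius_space_visual rho : moebius_space w rho ->
  exists xi r, 0 < r <= 1 /\ rho = visual xi r.
Proof.
move=> [arho erho]; have [srho _ antir] := arho.
have [f df] := moebius_derivative_exists sw srho erho avoid2.
have [fc f0 fE] := df.
have [xi _ fmax] : exists2 c, c \in [set: Z] &
    forall t, t \in [set: Z] -> f t <= f c.
  apply: compact_EVT_max => //; last exact: continuous_subspaceT.
  exact: antipodal_inhabited arho.
have {}fmax x : f x <= f xi by apply: fmax; rewrite inE.
set r := (f xi)^-1.
have r0 : 0 < r by rewrite invr_gt0.
have r1 : r <= 1.
  have [y] := moebius_derivative_ge1 xi aw arho df.
  rewrite invf_le1 // !leNgt; apply: contra => fxi1.
  by rewrite mulr_ilt1 ?(ltW (f0 _)) // (le_lt_trans (fmax y)).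
have g0 x := gauge_gt0 xi x r0.
pose G x := r / gauge xi r x ^+ 2.
have G0 x : 0 < G x by rewrite divr_gt0 // exprn_gt0.
have GE x y : visual xi r x y ^+ 2 = G x * G y * w x y ^+ 2.
  by rewrite /visual /G; field; rewrite !gt_eqF.
have rho1 x y : f x * f y * w x y ^+ 2 <= 1.
  by rewrite -fE expr_le1 ?antipodal_le1 //; case: srho.
(* [f x <= f xi] inside the ball of radius [r] around [xi], and
   [rho x xi <= 1] outside. *)
have fG x : f x <= G x.
  rewrite ler_pdivlMr ?exprn_gt0 // /gauge.
  have [_|_] := leP (w x xi) r.
    by rewrite expr2 mulrA ler_piMl ?(ltW r0) // /r ler_pdivrMr // mul1r.
  by rewrite /r -[leRHS]div1r ler_pdivlMr // mulrAC.
exists xi, r; split; first by rewrite r0.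
(* Compare the two functions between [x] and its antipode [y] for [rho]. *)
have {}fG x : f x = G x.
  apply/eqP; rewrite eq_le fG /=; have [y xy] := antir x.
  have : G x * G y * w x y ^+ 2 <= f x * f y * w x y ^+ 2.
    rewrite -GE -fE xy expr1n expr_le1 ?visual_le1 //.
    by case: (visual_separating xi r0).
  have wxy : 0 < w x y ^+ 2.
    apply/exprn_gt0/(separating_gt0 sw) => exy; move: xy.
    by rewrite exy separatingxx // => /esym/eqP; rewrite oner_eq0.
  rewrite ler_pM2r // => h; rewrite -(ler_pM2r (G0 y)) (le_trans h) //.
  by rewrite ler_pM2l.
apply/funext => x; apply/funext => y; apply/eqP.
rewrite -(@eqrXn2 _ 2) //; first by rewrite fE GE !fG.
  by case: srho.
by case: (visual_separating xi r0).
Qed.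

End visual.

(** * Distances and Gromov products of visual functions *)

Section visual_gromov.
Variables (R : realType) (Z : topologicalType) (w : Z -> Z -> R).
Hypotheses (aw : antipodal w) (uw : ultrametric w).
Hypothesis avoid2 : forall x y : Z, exists z, z <> x /\ z <> y.

Let sw : separating w. Proof. by case: aw. Qed.

Lemma dist_visualE xi (a : R) eta (b : R) : 0 < a <= 1 -> 0 < b <= 1 ->
  moebius_dist (visual w xi a) (visual w eta b) =
    2 * ln (Num.max (w xi eta) (Num.max a b)) - ln a - ln b.
Proof.
move=> a01 b01; rewrite dist_visual //.
have [/andP[a0 _] /andP[b0 _]] := (a01, b01).
have m0 : 0 < Num.max (w xi eta) (Num.max a b) by rewrite !lt_max a0 orbT.
rewrite lnM ?posrE ?exprn_gt0 ?invr_gt0 ?mulr_gt0 // lnV ?posrE ?mulr_gt0 //.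
by rewrite lnM ?posrE // lnXn // mulr_natl opprD addrA.
Qed.

Lemma dist_visual_base xi (a : R) : 0 < a <= 1 ->
  moebius_dist (visual w xi a) w = - ln a.
Proof.
move=> a01; have /andP[_ a1] := a01.
rewrite -[X in moebius_dist _ X](visual1 aw xi).
rewrite dist_visualE ?ltr01 ?lexx // separatingxx // (max_r a1) max_r //.
by rewrite ln1 mulr0 sub0r subr0.
Qed.

Lemma gromov_product_visual xi (a : R) eta (b : R) : 0 < a <= 1 -> 0 < b <= 1 ->
  gromov_product moebius_dist w (visual w xi a) (visual w eta b) =
    - ln (Num.max (w xi eta) (Num.max a b)).
Proof.
move=> a01 b01.
rewrite /gromov_product !dist_visual_base // dist_visualE //.
by move: (ln a) (ln b) (ln _) => la lb lm; field.
Qed.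

End visual_gromov.

(** * The Moebius space is a tree *)

Section tree.
Variables (R : realType) (Z : topologicalType) (w : Z -> Z -> R).
Hypotheses (aw : antipodal w) (uw : ultrametric w).
Hypothesis avoid2 : forall x y : Z, exists z, z <> x /\ z <> y.
Hypothesis cptZ : compact [set: Z].

Lemma moebius_space_eq (v : Z -> Z -> R) :
  moebius_space w v -> moebius_space v = moebius_space w.
Proof.
move=> [_ ev]; apply/seteqP; split => rho [arho e]; split=> // x x' y y' u.
  by rewrite e // ev.
by rewrite e // ev.
Qed.

Lemma moebius_space_ultrametric rho : moebius_space w rho -> ultrametric rho.
Proof.
move=> [arho erho]; have [[sw _ _] [srho _ _]] := (aw, arho).
have [f df] := moebius_derivative_exists sw srho erho avoid2.
apply: four_point_ultrametric => //.
exact/(four_point_conformal sw srho df)/ultrametric_four_point.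
Qed.

(** As all elements of the space are ultrametrics, the parametrization is
available from any base point [v]. *)
Lemma moebius_space_visual_from v rho :
  moebius_space w v -> moebius_space w rho ->
  exists xi (r : R), 0 < r <= 1 /\ rho = visual v xi r.
Proof.
move=> Mv Mrho; have [antiv _] := Mv; apply: moebius_space_visual => //.
  exact: moebius_space_ultrametric.
by rewrite moebius_space_eq.
Qed.

Lemma moebius_space_gromov_product_ge0 v x y :
  moebius_space w v -> moebius_space w x -> moebius_space w y ->
  0 <= gromov_product moebius_dist v x y.
Proof.
move=> Mv Mx My; have [antiv _] := Mv.
have uv := moebius_space_ultrametric Mv.
have [xi [a [a01 ->]]] := moebius_space_visual_from Mv Mx.
have [eta [b [b01 ->]]] := moebius_space_visual_from Mv My.
rewrite gromov_product_visual // oppr_ge0 ln_le0 // !ge_max antipodal_le1 //.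
by move: a01 b01 => /andP[_ ->] /andP[_ ->].
Qed.

(** Seen from one of its two points, a distance is [- ln r]; the triangle
inequality is the nonnegativity of the Gromov product at the middle point. *)
Lemma moebius_space_metric : is_metric (moebius_space w) moebius_dist.
Proof.
have distC x y : moebius_space w x -> moebius_space w y ->
    moebius_dist x y = moebius_dist y x.
  move=> [[sx _ _] ex] [[sy _ _] ey]; apply: moebius_distC => //.
  by move=> *; rewrite ex // ey.
have distE x y : moebius_space w x -> moebius_space w y ->
    exists xi (r : R), [/\ 0 < r <= 1, x = visual y xi r &
      moebius_dist x y = - ln r].
  move=> Mx My; have [xi [r [r01 xE]]] := moebius_space_visual_from My Mx.
  have [ay _] := My; exists xi, r; split => //.
  by rewrite {1}xE dist_visual_base //; exact: moebius_space_ultrametric.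
split.
- move=> x y Mx My; have [xi [r [/andP[_ r1] _ ->]]] := distE _ _ Mx My.
  by rewrite oppr_ge0 ln_le0.
- move=> x y Mx My; split=> [|<-].
    have [xi [r [/andP[r0 _] -> ->]]] := distE _ _ Mx My.
    have [ay _] := My.
    by move=> /eqP; rewrite oppr_eq0 ln_eq0 // => /eqP ->; exact: visual1.
  have [ax _] := Mx; have [xi _] := antipodal_inhabited ax.
  rewrite -[X in moebius_dist X](visual1 ax xi).
  rewrite dist_visual_base ?ltr01 ?lexx //.
    by rewrite ln1 oppr0.
  exact: moebius_space_ultrametric.
- exact: distC.
- move=> x y z Mx My Mz; have := moebius_space_gromov_product_ge0 My Mx Mz.
  by rewrite /gromov_product (distC y z) // pmulr_lge0 // subr_ge0.
Qed.

(** A geodesic from [x] follows the ray from [x] on which [y] lies. *)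
Lemma moebius_space_geodesic : geodesic (moebius_space w) moebius_dist.
Proof.
move=> x y Mx My; have [ax _] := Mx; have ux := moebius_space_ultrametric Mx.
have [eta [b [b01 yE]]] := moebius_space_visual_from Mx My.
have [_ _ distC _] := moebius_space_metric.
have dxy : moebius_dist x y = - ln b by rewrite distC // yE dist_visual_base.
have e01 (t : R) : 0 <= t -> 0 < expR (- t) <= 1.
  by move=> t0; rewrite expR_gt0 expR_le1 oppr_le0.
have /andP[b0 _] := b01.
exists (fun t => visual x eta (expR (- t))); split.
- by rewrite oppr0 expR0 visual1.
- by rewrite dxy opprK lnK ?posrE // -yE.
- move=> t /andP[t0 _]; rewrite -(moebius_space_eq Mx).
  by apply: visual_moebius_space => //; exact: e01.
- move=> s t /andP[s0 _] /andP[t0 _]; rewrite dist_visualE ?e01 // !expRK.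
  have [sx _ _] := ax; rewrite separatingxx //.
  rewrite [Num.max 0 _]max_r ?le_max ?expR_ge0 //.
  have [st|ts] := leP s t.
    by rewrite max_l ?ler_expR ?lerN2 // expRK ler0_norm ?subr_le0 //; ring.
  by rewrite max_r ?ler_expR ?lerN2 ?ltW // expRK gtr0_norm ?subr_gt0 //; ring.
Qed.

(** At the base point [v] the condition becomes the ultrametric inequality for
[v], between the radii and the end points of the rays. *)
Lemma moebius_space_zero_hyperbolic :
  zero_hyperbolic (moebius_space w) moebius_dist.
Proof.
move=> v x y z Mv Mx My Mz; have [antiv _] := Mv.
have uv := moebius_space_ultrametric Mv.
have [xi [a [a01 ->]]] := moebius_space_visual_from Mv Mx.
have [eta [b [b01 ->]]] := moebius_space_visual_from Mv My.
have [zeta [c [c01 ->]]] := moebius_space_visual_from Mv Mz.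
rewrite !gromov_product_visual // -oppr_max lerN2.
have [[/andP[a0 _] /andP[b0 _]] /andP[c0 _]] := (a01, b01, c01).
have pos p (q r : R) : 0 < q -> Num.max p (Num.max q r) \is Num.pos.
  by move=> q0; rewrite posrE !lt_max q0 orbT.
rewrite le_max !ler_ln ?pos // -le_max !ge_max !le_max !lexx !orbT !andbT.
have := uv xi zeta eta; rewrite le_max => /orP[] ->; by rewrite ?orbT.
Qed.

Lemma moebius_space_tree : is_tree (moebius_space w) moebius_dist.
Proof.
split; [exact: moebius_space_metric | exact: moebius_space_geodesic |].
exact: moebius_space_zero_hyperbolic.
Qed.

End tree.

Theorem proposition8p13 (R : realType) (Z : topologicalType)
    (alpha : Z -> Z -> R) (hZ : antipodal_space alpha)
    (hultra : exists rho0, moebius_space alpha rho0 /\ ultrametric rho0) :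
  is_tree (moebius_space alpha) moebius_dist /\
  (forall rho, moebius_space alpha rho -> ultrametric rho).
Proof.
have [cptZ _ card4 _] := hZ; have [rho0 [Mrho0 urho0]] := hultra.
have avoid2 (x y : Z) : exists z, z <> x /\ z <> y by exact: card_ge4_avoid2.
have [arho0 _] := Mrho0; rewrite -(moebius_space_eq Mrho0).
by split; [exact: moebius_space_tree | exact: moebius_space_ultrametric].
Qed.
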